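(* A complete Boolean algebra $A$ is isomorphic to an algebra of the form $RC(X)$, where $X$ is a (zero-dimensional) Eberlein compact, if and only if $A$ has a $\sigma$-disjointed dense subset. (The assertion holds both with and without the word ''zero-dimensional''.)
   Context: $RC(X)$ is the Boolean algebra of regular closed subsets of $X$ ($F=\mathrm{cl}(\mathrm{int}(F))$), with $F\vee G=F\cup G$, $F\wedge G=\mathrm{cl}(\mathrm{int}(F\cap G))$, $F^*=\mathrm{cl}(X\setminus F)$. An Eberlein compact is a compact Hausdorff space homeomorphic to a weakly compact subset of a Banach space. Zero-dimensional means having a base of clopen sets. A subset $B$ of a Boolean algebra $A$ is dense if for every $a\in A\setminus\{0\}$ there is $b\in B\setminus\{0\}$ with $b\le a$. A $\sigma$-disjointed dense subset of $A$ is a dense subset $B$ of $A$ such that $B=\bigcup\{B_n\mid n\in\mathbb{N}^+\}$, where for every $n\in\mathbb{N}^+$ and any two different elements $a,b$ of $B_n$ we have $a\wedge b=0$. *)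

(* Defs.v *)
From HB Require Import structures.
From mathcomp Require Import all_boot all_order all_algebra.
From mathcomp Require Import all_classical all_reals all_analysis.

Set Implicit Arguments.
Unset Strict Implicit.
Unset Printing Implicit Defensive.

Import Order.TTheory GRing.Theory Num.Theory.
Import numFieldNormedType.Exports.

Local Open Scope classical_set_scope.

Fact RC_display : Order.disp_t. Proof. exact: (Order.Disp tt tt). Qed.

Section RegularClosedAlgebra.
Variable X : topologicalType.

Record RC := MkRC { RCset :> set X ; RC_subproof : `[< regclosed RCset >] }.

HB.instance Definition _ := [isSub for RCset].
HB.instance Definition _ := [Choice of RC by <:].
(* The order inherited from [set X] is inclusion. *)
HB.instance Definition _ :=
  Order.SubChoice_isSubPOrder.Build _ (set X) _ RC_display RC.

Implicit Types F G H : RC.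

Lemma RC_leE F G : (F <= G)%O = `[< (F : set X) `<=` G >].
Proof. by []. Qed.

Lemma RC_regclosed F : regclosed F.
Proof. exact/asboolP/(RC_subproof F). Qed.

Lemma RC_closed F : closed F.
Proof. by rewrite -(RC_regclosed F); exact: closed_closure. Qed.

Lemma regclosedU F G : regclosed (F `|` G).
Proof.
apply/seteqP; split.
  have cFG : closed ((F : set X) `|` G) by apply: closedU; exact: RC_closed.
  rewrite [X in _ `<=` X](closure_id _).1//.
  by apply: closureS; exact: interior_subset.
rewrite -{1}(RC_regclosed F) -{1}(RC_regclosed G) -closureU.
exact/closureS/interiorU.
Qed.

Lemma regclosed0 : regclosed (set0 : set X).
Proof. by rewrite /regclosed interior0 closure0. Qed.

Lemma regclosedT : regclosed (setT : set X).
Proof. by rewrite /regclosed interiorT closureT. Qed.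

Definition RC_join F G : RC := MkRC (asboolT (regclosedU F G)).

Definition RC_meet F G : RC :=
  @MkRC (closure ((F : set X) `&` G)°)
    (asboolT (closure_open_regclosed (open_interior _))).

Definition RC_compl F : RC :=
  @MkRC (closure (~` F))
    (asboolT (closure_open_regclosed (closed_openC (@RC_closed F)))).

Lemma RC_meetP F G H : (F <= RC_meet G H)%O = (F <= G)%O && (F <= H)%O.
Proof.
have meetS (K : RC) : ((G : set X) `&` H) `<=` K -> RC_meet G H `<=` K.
  move=> GHK; rewrite /= -(RC_regclosed K); exact/closureS/interiorS.
rewrite !RC_leE; apply/asboolP/andP => [FGH|[/asboolP FG /asboolP FH]].
  by split; apply/asboolP; apply: (subset_trans FGH); apply: meetS => x [].
by rewrite -{1}(RC_regclosed F); apply/closureS/interiorS => x Fx; split; auto.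
Qed.

Lemma RC_joinP F G H : (RC_join F G <= H)%O = (F <= H)%O && (G <= H)%O.
Proof.
rewrite !RC_leE; apply/asboolP/andP => [FGH|[/asboolP FH /asboolP GH]].
  by split; apply/asboolP => x ?; apply: FGH; [left|right].
by move=> x []; auto.
Qed.

HB.instance Definition _ :=
  Order.POrder_MeetJoin_isLattice.Build RC_display RC RC_meetP RC_joinP.

Lemma RC_meetUl : left_distributive RC_meet RC_join.
Proof.
move=> F G H; apply/val_inj/seteqP; split => /=; last first.
  by rewrite -closureU; apply/closureS; rewrite setIUl; exact: interiorU.
rewrite -closureU [X in _ `<=` X](closure_id _).1; last exact: closed_closure.
apply: closureS => x FGHx W Wx.
have [V [oV Vx] VW] : exists2 V, open_nbhs x V & V `<=` W `&` ((F `|` G) `&` H).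
  have : nbhs x (W `&` ((F `|` G) `&` H)) by exact: filterI.
  by rewrite nbhsE => -[V oV VW]; exists V.
have [VF|] := pselect (V `<=` F).
  exists x; split; last by have [] := VW _ Vx.
  left; rewrite /interior nbhsE; exists V => // y Vy.
  by split; [exact: VF | have [_ []] := VW _ Vy].
move=> /existsNP [y /not_implyP [Vy nFy]].
exists y; split; last by have [] := VW _ Vy.
right; rewrite /interior nbhsE; exists (V `&` ~` F).
  by split; [apply: openI => //; exact/closed_openC/RC_closed | split].
by move=> z [Vz nFz]; have [_ [[//|Gz] Hz]] := VW _ Vz.
Qed.

HB.instance Definition _ :=
  Order.Lattice_Meet_isDistrLattice.Build RC_display RC RC_meetUl.

Lemma RC_le0 F : (MkRC (asboolT regclosed0) <= F)%O.
Proof. by rewrite RC_leE; apply/asboolP. Qed.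

HB.instance Definition _ := Order.hasBottom.Build RC_display RC RC_le0.

Lemma RC_leT F : (F <= MkRC (asboolT regclosedT))%O.
Proof. by rewrite RC_leE; apply/asboolP. Qed.

HB.instance Definition _ := Order.hasTop.Build RC_display RC RC_leT.

Lemma RC_joinC F : RC_join F (RC_compl F) = \top%O.
Proof.
apply/val_inj/seteqP; split => // x _ /=.
by have [?|?] := pselect ((F : set X) x); [left|right; exact: subset_closure].
Qed.

Lemma RC_meetC F : RC_meet F (RC_compl F) = \bot%O.
Proof.
apply/val_inj; rewrite /= closure_setC.
suff -> : ((F : set X) `&` ~` (F : set X)°)° = set0 by rewrite closure0.
apply/seteqP; split => // x /=; rewrite interiorI => -[Fx].
by move=> /interior_subset; apply.
Qed.

HB.instance Definition _ :=
  Order.TBDistrLattice_hasComplement.Build RC_display RC RC_joinC RC_meetC.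

End RegularClosedAlgebra.

Section BooleanAlgebra.
Variables (d : Order.disp_t) (A : ctbDistrLatticeType d).

Definition complete_algebra := forall S : set A, exists m, isLub S m.

Definition dense_subset (B : set A) :=
  forall a : A, a != \bot%O ->
    exists b : A, [/\ B b, b != \bot%O & (b <= a)%O].

Definition sigma_disjointed (B : set A) :=
  exists2 B_ : nat -> set A, B = \bigcup_n B_ n &
    forall n (a b : A), B_ n a -> B_ n b -> a != b -> (a `&` b = \bot)%O.

Definition has_sigma_disjointed_dense_subset :=
  exists B : set A, dense_subset B /\ sigma_disjointed B.

End BooleanAlgebra.

Definition boolean_isomorphic (d d' : Order.disp_t)
    (A : ctbDistrLatticeType d) (A' : ctbDistrLatticeType d') :=
  exists f : A -> A',
    [/\ bijective f,
        {morph f : x y / (x `&` y)%O},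
        {morph f : x y / (x `|` y)%O} &
        {morph f : x / (~` x)%O}].

Definition homeomorphic (X Y : topologicalType) :=
  exists (f : X -> Y) (g : Y -> X),
    [/\ cancel f g, cancel g f, continuous f & continuous g].

(* The library's [zero_dimensional] only asks that clopen sets separate points,
   which is weaker in general. *)
Definition has_clopen_basis (X : topologicalType) :=
  exists B : set (set X), basis B /\ B `<=` clopen.

Section Eberlein.
Variable R : realType.

Definition continuous_dual (V : normedModType R) :=
  {phi : {linear V -> R^o} | continuous phi}.

(* [V] with the coarsest topology making all continuous linear functionals
   continuous. *)
Definition weak_space (V : normedModType R) : topologicalType :=
  sup_topology (fun phi : continuous_dual V =>
    Topological.class (initial_topology (sval phi))).

(* In [homeomorphic X K], [K] carries its subspace topology. *)
Definition Eberlein_compact (X : topologicalType) :=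
  [/\ compact [set: X], hausdorff_space X &
      exists (V : completeNormedModType R) (K : set (weak_space V)),
        compact K /\ homeomorphic X K].

End Eberlein.

(* Main.v *)
(* Necessity. A weakly compact set [K] is fragmented by the norm: every nonempty
   relatively weakly open set contains one of small norm diameter. Let [U_ n] be
   a maximal disjoint family of nonempty weakly open sets of diameter at most
   [1/(n+1)]. Its union is dense, so by Baire's theorem any nonempty open [O]
   contains a point [x] lying in some [W n \in U_ n] for every [n]; as [O] is
   norm open, [W n `<=` O] for large [n]. The closures of the members of the
   [U_ n] thus form a sigma-disjointed dense subset of [RC K]. This avoids
   embedding [K] in some c_0.

   Sufficiency. Let [X] be the Stone space of the subalgebra generated by a
   sigma-disjointed dense subset [\bigcup_n B_ n]. The subalgebra is dense, so
   [RC X] is isomorphic to the complete algebra [A]. An ultrafilter contains at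
   most one member of each [B_ n]; mapping it to the function with value [2^-n]
   at the members of [B_ n] it contains, and 0 elsewhere, embeds [X] in l_infty.
   The embedding is weakly continuous because a continuous functional is small
   on all but finitely many unit vectors. *)
Require Import Defs.
From HB Require Import structures.
From mathcomp Require Import all_boot all_order all_algebra.
From mathcomp Require Import all_classical all_reals all_analysis.
From mathcomp Require Import lra.

Set Implicit Arguments.
Unset Strict Implicit.
Unset Printing Implicit Defensive.

Import Order.CTheory Order.TTheory GRing.Theory Num.Theory.
Import numFieldNormedType.Exports.

Local Open Scope classical_set_scope.
Local Open Scope ring_scope.

(** * The Hahn-Banach theorem *)

Section HahnBanach.
Variables (R : realType) (V : lmodType R).
Implicit Types x y : V.

(** Homogeneity is asked as an inequality for [t > 0] only, the form that is checked for infima;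
    applying it to [t^-1] gives equality. *)
Definition sublinear (q : V -> R) :=
  (forall x y, q (x + y) <= q x + q y) /\
  (forall t x, 0 < t -> q (t *: x) <= t * q x).

Lemma sublinear0 (q : V -> R) : sublinear q -> q 0 = 0.
Proof.
move=> [_ qZ]; have := qZ 2 0 (ltr0n _ 2); have := qZ 2^-1 0.
rewrite !scaler0 invr_gt0 ltr0n => /(_ isT) ? ?; lra.
Qed.

Lemma sublinearZ (q : V -> R) t x : sublinear q -> 0 <= t -> q (t *: x) = t * q x.
Proof.
move=> qs; have [_ qZ] := qs.
rewrite le_eqVlt => /predU1P[<-|t0]; first by rewrite scale0r mul0r sublinear0.
apply/eqP; rewrite eq_le qZ//= -ler_pdivlMl//.
by rewrite -{1}[x](scalerK (lt0r_neq0 t0)) qZ// invr_gt0.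
Qed.

Lemma sublinear_geN (q : V -> R) x : sublinear q -> - q (- x) <= q x.
Proof.
by move=> qs; have := qs.1 x (- x); rewrite subrr (sublinear0 qs); lra.
Qed.

(** Serves for shifts, for chains in Zorn's lemma and for the distance to a subspace. The index [k]
    merges near-optimal indices chosen separately for [x] and [y]. *)
Lemma sublinear_inf (I : Type) (i0 : I) (q : I -> V -> R) :
  (forall x, has_lbound (range (q^~ x))) ->
  (forall i j, exists k, forall x y, q k (x + y) <= q i x + q j y) ->
  (forall i t, 0 < t -> exists k, forall x, q k (t *: x) <= t * q i x) ->
  sublinear (fun x => inf (range (q^~ x))).
Proof.
move=> lb qD qZ; have ne x : range (q^~ x) !=set0 by exists (q i0 x), i0.
have inf_le i x : inf (range (q^~ x)) <= q i x by apply: ge_inf => //; exists i.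
split=> [x y|t x t0].
  rewrite -lerBlDr; apply: lb_le_inf => // _ [i _ <-].
  rewrite lerBlDl -lerBlDr; apply: lb_le_inf => // _ [j _ <-].
  have [k qk] := qD i j; have := inf_le k (x + y); have := qk x y; lra.
rewrite -ler_pdivrMl//; apply: lb_le_inf => // _ [i _ <-].
rewrite ler_pdivrMl//; have [k qk] := qZ i t t0.
exact: le_trans (inf_le k _) (qk x).
Qed.

(** For sublinear [q], the greatest sublinear functional below [q] whose value at [- y] is at most
    [- q y]. *)
Definition sublinear_shift (q : V -> R) y x :=
  inf (range (fun t : {t : R | 0 <= t} => q (x + sval t *: y) - sval t * q y)).

Lemma sublinear_shiftP (q : V -> R) y : sublinear q ->
  [/\ sublinear (sublinear_shift q y),
      forall x, sublinear_shift q y x <= q x &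
      sublinear_shift q y (- y) <= - q y].
Proof.
move=> qs; have lb x : has_lbound (range (fun t : {t : R | 0 <= t} =>
    q (x + sval t *: y) - sval t * q y)).
  exists (- q (- x)) => _ [[t t0] _ <-] /=; rewrite -(sublinearZ _ qs)//.
  have := qs.1 (x + t *: y) (- x); rewrite addrAC subrr add0r; lra.
have le_q t x : 0 <= t -> sublinear_shift q y x <= q (x + t *: y) - t * q y.
  by move=> t0; apply: ge_inf => //; exists (exist _ t t0).
split=> [|x|]; first apply: sublinear_inf => //.
- by exists 0; rewrite lexx.
- move=> [s s0] [t t0]; exists (exist _ (s + t) (addr_ge0 s0 t0)) => x z /=.
  rewrite scalerDl addrACA; have := qs.1 (x + s *: y) (z + t *: y); lra.
- move=> [s s0] t t0.
  exists (exist _ (t * s) (mulr_ge0 (ltW t0) s0)) => x /=.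
  rewrite -scalerA -scalerDr -mulrA mulrBr lerD2r; exact: qs.2.
- by have := le_q 0 x (lexx _); rewrite scale0r mul0r addr0 subr0.
- have := le_q 1 (- y) ler01.
  by rewrite scale1r addNr sublinear0// mul1r sub0r.
Qed.

(* A minimal sublinear functional [q] is odd, hence linear, because
   [sublinear_shift q y <= q] must be an equality. *)
Lemma sublinear_dominates_linear (p : V -> R) : sublinear p ->
  exists2 q : V -> R,
    {morph q : x y / x + y} /\
    (forall t, {morph q : x / t *: x >-> t * x})
    & forall x, q x <= p x.
Proof.
move=> ps.
pose T := {q | sublinear q /\ forall x, q x <= p x}.
(* The order is reversed, so that a maximal element for [le_T] is a minimal functional. *)
pose le_T (q r : T) := `[< forall x, sval r x <= sval q x >].
have leTP (q r : T) : le_T q r <-> forall x, sval r x <= sval q x.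
  by split=> /asboolP.
have p_in : sublinear p /\ forall x, p x <= p x by [].
have [||A tA|[q [qs qp]] qmin] := @ZL_preorder T (exist _ p p_in) le_T.
- by move=> q; apply/leTP.
- by move=> r q s /leTP qr /leTP sq; apply/leTP => x; apply: le_trans (qr x).
(* The empty chain is bounded by [p], any other by its pointwise infimum. *)
- have [[q0 Aq0]|A0] := pselect (exists q, A q); last first.
    by exists (exist _ p p_in) => s As; case: A0; exists s.
  pose I := {q | A q}; pose F (i : I) := sval (sval i).
  have Fs (i : I) : sublinear (F i) by exact: (svalP (sval i)).1.
  have Fp (i : I) x : F i x <= p x by exact: (svalP (sval i)).2.
  have lb x : has_lbound (range (F^~ x)).
    exists (- p (- x)) => _ [i _ <-].
    by have := sublinear_geN x (Fs i); have := Fp i (- x); lra.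
  have rs : sublinear (fun x => inf (range (F^~ x))).
    apply: sublinear_inf => //; first by exists q0.
      move=> [i Ai] [j Aj]; have [/leTP ij|/leTP ji] := tA _ _ Ai Aj.
        exists (exist _ j Aj) => x y; apply: le_trans ((Fs _).1 x y) _.
        by rewrite lerD2r; exact: ij.
      exists (exist _ i Ai) => x y; apply: le_trans ((Fs _).1 x y) _.
      by rewrite lerD2l; exact: ji.
    by move=> i t t0; exists i => x; exact: (Fs i).2.
  have r_le i x : inf (range (F^~ x)) <= F i x by apply: ge_inf => //; exists i.
  have r_in : sublinear (fun x => inf (range (F^~ x))) /\
      forall x, inf (range (F^~ x)) <= p x.
    split=> // x; apply: le_trans (Fp (exist _ q0 Aq0) x); exact: r_le.
  exists (exist (fun q => sublinear q /\ forall x, q x <= p x) _ r_in) => s As.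
  apply/leTP => x.
  exact: (r_le (exist _ s As)).
have qN y : q (- y) = - q y.
  have [ss sq sN] := sublinear_shiftP y qs.
  have s_in : sublinear (sublinear_shift q y) /\
      forall x, sublinear_shift q y x <= p x.
    by split=> // x; apply: le_trans (sq x) (qp x).
  have /leTP/(_ (- y))/= := qmin
    (exist (fun q => sublinear q /\ forall x, q x <= p x) _ s_in) (asboolT sq).
  by have := sublinear_geN (- y) qs; rewrite opprK; lra.
have qD : {morph q : x y / x + y}.
  move=> x y; apply/eqP; rewrite eq_le qs.1 /=.
  by have := qs.1 (- x) (- y); rewrite -opprD !qN; lra.
exists q => //; split=> // t x; have [t0|/ltW t0] := lerP 0 t.
  exact: sublinearZ.
by rewrite -{1}[t]opprK scaleNr qN sublinearZ ?oppr_ge0// mulNr opprK.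
Qed.

(** A linear [f] below the shift of [p] at [x] has [f (- x) <= - p x], which is the missing
    inequality [p x <= f x]. *)
Lemma hahn_banach (p : V -> R) x : sublinear p ->
  exists f : {linear V -> R^o}, (forall y, f y <= p y) /\ f x = p x.
Proof.
move=> ps; have [ss sp sN] := sublinear_shiftP x ps.
have [q [qD qZ] qs] := sublinear_dominates_linear ss.
have qlin : linear_for *:%R (q : V -> R^o) by move=> t y z; rewrite qD qZ.
pose f : {linear V -> R^o} := HB.pack (q : V -> R^o)
  (GRing.isLinear.Build R V R^o *:%R q qlin).
exists f; rewrite /f /=; have qp y := le_trans (qs y) (sp y); split=> //.
apply/eqP; rewrite eq_le qp -lerN2; apply: le_trans sN.
by apply: le_trans (qs (- x)); rewrite -scaleN1r qZ mulN1r.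
Qed.

End HahnBanach.

Section NormedHahnBanach.
Variables (R : realType) (V : normedModType R).

Lemma linear_le_norm_continuous (f : {linear V -> R^o}) :
  (forall x, f x <= `|x|) -> continuous f.
Proof.
move=> f_le; apply: bounded_linear_continuous; apply/linear_boundedP.
exists 1; split=> // r r1 x; have fx := f_le x; have fNx := f_le (- x).
rewrite linearN normrN in fNx.
rewrite ler_norml; have : `|x| <= r * `|x| by rewrite ler_peMl// ltW.
lra.
Qed.

(** The dominating functional is the distance to [W]: at most the norm, at least [d] at [x], and at
    most 0 on [W], where stability under negation then forces [f] to vanish. *)
Lemma hahn_banach_distance (W : set V) (x : V) (d : R) :
  W 0 -> (forall u v, W u -> W v -> W (u + v)) ->
  (forall t u, W u -> W (t *: u)) ->
  (forall w, W w -> d <= `|x - w|) ->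
  exists f : continuous_dual V,
    [/\ forall y, sval f y <= `|y|, forall w, W w -> sval f w = 0 &
        d <= sval f x].
Proof.
move=> W0 WD WZ dW.
pose q (w : {w | W w}) y := `|y - sval w|.
have lb y : has_lbound (range (q^~ y)) by exists 0 => _ [w _ <-]; exact: normr_ge0.
have qs : sublinear (fun y => inf (range (q^~ y))).
  apply: sublinear_inf => //; first by exists 0.
    move=> [u Wu] [v Wv]; exists (exist _ _ (WD _ _ Wu Wv)) => y z.
    by rewrite /q /= opprD addrACA ler_normD.
  move=> [u Wu] t t0; exists (exist _ _ (WZ t _ Wu)) => y.
  by rewrite /q /= -scalerBr normrZ gtr0_norm.
have q_le w y (Ww : W w) : inf (range (q^~ y)) <= `|y - w|.
  by apply: ge_inf => //; exists (exist _ w Ww).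
have [f [fq fx]] := hahn_banach x qs.
have f1 y : f y <= `|y| by rewrite (le_trans (fq y))// -{2}[y]subr0 q_le.
have f0 w : W w -> f w <= 0.
  by move=> Ww; rewrite (le_trans (fq w))// (le_trans (q_le w w Ww))// subrr normr0.
exists (exist _ f (linear_le_norm_continuous f1)); split=> //= [w Ww|].
  have := f0 _ Ww; have := f0 _ (WZ (- 1) _ Ww); rewrite scaleN1r linearN /=; lra.
rewrite fx; apply: lb_le_inf; first by exists (q (exist _ 0 W0) x), (exist _ 0 W0).
by move=> _ [[w Ww] _ <-]; exact: dW.
Qed.

End NormedHahnBanach.

(** * Fragmentability of weakly compact sets *)

Section CompactBaire.
Variable X : topologicalType.
Hypotheses (cX : compact [set: X]) (hX : hausdorff_space X).

Lemma open_shrink (U : set X) x : open U -> U x ->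
  exists W, [/\ open W, W x & closure W `<=` U].
Proof.
move=> oU Ux; have reg : {for x, @regular_space X}.
  by apply: (compact_regular hX cX); exact: filterT.
have [W Wx WU] := reg U (open_nbhs_nbhs (conj oU Ux)).
exists W°; split=> //; first exact: open_interior.
exact: subset_trans (closureS (@interior_subset _ W)) WU.
Qed.

(** Any cluster point of [x] lies in the closure of each [U n.+1], since the sequence stays there
    from [n.+1] on. *)
Lemma nested_cluster (U : nat -> set X) (x : nat -> X) :
  (forall n, closure (U n.+1) `<=` U n) -> (forall n, U n (x n)) ->
  exists2 p, cluster (x @ \oo) p & forall n, U n p.
Proof.
move=> cU Ux; have [p [_ xp]] : [set: X] `&` cluster (x @ \oo) !=set0.
  by apply: cX; exact: filterT.
have Umono n m : (n <= m)%N -> U m `<=` U n.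
  elim: m => [|m IH]; first by rewrite leqn0 => /eqP->.
  rewrite leq_eqVlt => /predU1P[<-//|/IH mn] y Uy.
  by apply: mn; apply: cU; exact: subset_closure.
exists p => // n; apply: cU => B Bp.
by apply: xp => //; exists n.+1 => // m /= /Umono; apply.
Qed.

Lemma compact_baire (G : nat -> set X) (O : set X) :
  (forall n, open (G n)) -> open O -> O !=set0 ->
  (forall n W, open W -> W !=set0 -> W `<=` O -> W `&` G n !=set0) ->
  exists2 x, O x & forall n, G n x.
Proof.
move=> oG oO O0 dG; pose P (W : set X) := [/\ open W, W !=set0 & W `<=` O].
(* Each set shrinks to one whose closure lies in it and in [G n]; iteration from [O] gives nested
   sets with a common point. Where [P] fails, [set0] is a dummy value. *)
have step (nW : nat * set X) : exists W', P nW.2 ->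
    P W' /\ closure W' `<=` nW.2 `&` G nW.1.
  case: nW => n W /=; have [[oW W0 WO]|nP] := pselect (P W); last by exists set0.
  have [x WGx] := dG n W oW W0 WO.
  have [W' [oW' W'x W'WG]] := open_shrink (openI oW (oG n)) WGx.
  exists W' => _; split=> //; split=> //; first by exists x.
  by move=> y /subset_closure/W'WG[/WO].
have [f fP] := choice step.
pose U := fix U n := if n is m.+1 then f (m, U m) else O.
have UP n : P (U n).
  by elim: n => [|n IH]; [split|case: (fP (n, U n) IH)].
have cU n : closure (U n.+1) `<=` U n `&` G n by case: (fP (n, U n) (UP n)).
have /choice[x Ux] : forall n, exists y, U n y by move=> n; case: (UP n).
have [|p _ Up] := @nested_cluster U x _ Ux; first by move=> n y /cU[].
exists p; first exact: (Up 0).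
by move=> n; have /subset_closure/cU[] := Up n.+1.
Qed.

(** Otherwise the complements of the [F i] are open and dense in [U], and Baire's theorem yields a
    point of [U] outside every [F i]. *)
Lemma compact_baire_cover (I : countType) (F : I -> set X) (U : set X) :
  (forall i, closed (F i)) -> open U -> U !=set0 -> U `<=` \bigcup_i F i ->
  exists i W, [/\ open W, W !=set0, W `<=` U & W `<=` F i].
Proof.
move=> cF oU U0 UF; apply: contrapT => noW.
(* Codes that name no index contribute the whole space. *)
pose G n := if @unpickle I n is Some i then ~` F i else setT.
have [|//|//||x Ux Gx] := @compact_baire G U.
- by move=> n; rewrite /G; case: unpickle => [i|]; [exact: closed_openC|exact: openT].
- move=> n W oW W0 WU; rewrite /G; case: unpickle => [i|]; last by rewrite setIT.
  apply/set0P/eqP => /disjoints_subset; rewrite setCK => WF.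
  by apply: noW; exists i, W.
have [i _ Fix] := UF x Ux.
by have := Gx (pickle i); rewrite /G pickleK.
Qed.

End CompactBaire.

Section SeparableSubspace.
Variables (R : realType) (V : normedModType R).

(** The countable family [d] has to approximate [W], not to lie in it, so that for [add_line] it
    suffices to add rational multiples of [v]. *)
Definition separable_subspace (W : set V) :=
  [/\ W 0, forall u v, W u -> W v -> W (u + v),
      forall t u, W u -> W (t *: u) &
      exists (I : countType) (d : I -> V),
        forall w e, W w -> 0 < e -> exists k, `|w - d k| < e].

Lemma separable_subspace0 : separable_subspace [set 0].
Proof.
split=> //= [u v -> ->|t u ->|]; rewrite ?addr0 ?scaler0//.
by exists unit, (fun=> 0) => w e ->; exists tt; rewrite subrr normr0.
Qed.

(** For a subspace [W], this is [W + R v]. *)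
Definition add_line (W : set V) (v : V) : set V :=
  [set u | exists t, W (u - t *: v)].

Lemma sub_add_line W v : W `<=` add_line W v.
Proof. by move=> w Ww; exists 0; rewrite scale0r subr0. Qed.

Lemma add_line_gen W v : W 0 -> add_line W v v.
Proof. by move=> W0; exists 1; rewrite scale1r subrr. Qed.

Lemma separable_add_line W v :
  separable_subspace W -> separable_subspace (add_line W v).
Proof.
move=> [W0 WD WZ [I [d dW]]]; split.
- exact: sub_add_line.
- move=> u w [s Wu] [t Ww]; exists (s + t).
  by rewrite scalerDl opprD addrACA; exact: WD.
- move=> a u [t Wu]; exists (a * t).
  by rewrite -scalerA -scalerBr; exact: WZ.
- exists (I * rat)%type, (fun kq => d kq.1 + ratr kq.2 *: v) => u e [t Wu] e0.
  have e2 : 0 < e / 2 by rewrite divr_gt0.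
  have [k dk] := dW _ _ Wu e2.
  (* The summand 1 keeps the divisor positive when [v = 0]. *)
  have v1 : 0 < `|v| + 1 by rewrite ltr_wpDl.
  have dt : t < t + e / 2 / (`|v| + 1) by rewrite ltrDl divr_gt0.
  have [q] := rat_in_itvoo dt; rewrite in_itv /= => /andP[tq qt].
  exists (k, q) => /=.
  have -> : u - (d k + ratr q *: v) = u - t *: v - d k + (t - ratr q) *: v.
    by rewrite scalerBl opprD !addrA; congr (_ - _); rewrite addrAC subrK.
  apply: le_lt_trans (ler_normD _ _) _; rewrite [ltRHS]splitr.
  apply: ltr_leD => //; rewrite normrZ ltr0_norm ?subr_lt0// opprB.
  have qt' : ratr q - t <= e / 2 / (`|v| + 1) by rewrite lerBlDl ltW.
  rewrite -[leRHS](divfK (lt0r_neq0 v1)); apply: ler_pM => //; rewrite ?lerDl//.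
  by rewrite subr_ge0 ltW.
Qed.

End SeparableSubspace.

Section Fragmentability.
Variables (R : realType) (V : normedModType R) (X : topologicalType).
Hypotheses (cX : compact [set: X]) (hX : hausdorff_space X).
Variable i : X -> V.
Hypothesis i_cont :
  forall phi : continuous_dual V, continuous (fun x => sval phi (i x)).

Lemma open_functional_gt (phi : continuous_dual V) (a : R) :
  open [set x | a < sval phi (i x)].
Proof.
apply: (@open_comp _ R (fun x => sval phi (i x)) [set z : R | a < z]).
  by move=> x _; exact: i_cont.
exact: open_gt.
Qed.

(** By Hahn-Banach a ball is an intersection of half-spaces given by functionals of norm at most 1,
    and each of these has a closed preimage. *)
Lemma closed_norm_ball (c : V) (r : R) : closed [set x | `|i x - c| <= r].
Proof.
have -> : [set x | `|i x - c| <= r] =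
    \bigcap_(phi in [set phi : continuous_dual V | forall y, sval phi y <= `|y|])
      [set x | sval phi (i x) <= r + sval phi c].
  apply/seteqP; split=> [x /= xr phi phi1 /=|x /= H].
    rewrite -lerBlDr -linearB; exact: le_trans (phi1 _) xr.
  have [||||phi [phi1 _ phix]] := @hahn_banach_distance R V [set 0] (i x - c) `|i x - c|.
  - by [].
  - by move=> u v /= -> ->; rewrite addr0.
  - by move=> t u /= ->; rewrite scaler0.
  - by move=> w /= ->; rewrite subr0.
  have /= := H phi phi1; rewrite -lerBlDr -linearB; exact: le_trans.
apply: closed_bigI => phi _.
apply: (@preimage_closed _ R (fun x => sval phi (i x))
  [set y : R | y <= r + sval phi c]).
  by move=> x _; exact: i_cont.
exact: closed_le.
Qed.

(** Otherwise [U] is mapped within [e / 4] of [W], hence into countably many closed balls of radius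
    [e / 2]; by Baire one of them contains the image of a nonempty open part of [U], of diameter at
    most [e]. *)
Lemma far_point (W : set V) (U : set X) (e : R) :
  separable_subspace W -> 0 < e -> open U -> U !=set0 ->
  (forall U', open U' -> U' !=set0 -> U' `<=` U ->
    exists x y, [/\ U' x, U' y & e < `|i x - i y|]) ->
  exists2 x, U x & forall w, W w -> e / 4 <= `|i x - w|.
Proof.
move=> [W0 WD WZ [I [d dW]]] e0 oU U0 big; apply: contrapT => near.
pose F (k : I) := [set x | `|i x - d k| <= e / 2].
have UF : U `<=` \bigcup_k F k.
  move=> x Ux; have [w Ww xw] : exists2 w, W w & `|i x - w| < e / 4.
    apply: contrapT => far; apply: near; exists x => // w Ww.
    by rewrite leNgt; apply/negP => xw; apply: far; exists w.
  have [k wk] := dW w (e / 4) Ww (divr_gt0 e0 (ltr0n _ 4)).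
  exists k => //; rewrite /F /=; have := ler_distD w (i x) (d k); lra.
have [|k [U' [oU' U'0 U'U U'F]]] := compact_baire_cover cX hX _ oU U0 UF.
  by move=> k; exact: closed_norm_ball.
have [x [y [U'x U'y xy]]] := big U' oU' U'0 U'U.
have := U'F _ U'x; have := U'F _ U'y; rewrite /F /= (distrC (i y)).
have := ler_distD (d k) (i x) (i y); lra.
Qed.

(* If no small open set existed, one could pick successively points [x n] and
   functionals [phi n] of norm at most 1, vanishing on the span [W n] of the
   previous points, with [phi n >= e / 8] on a neighbourhood of all later
   points. A cluster point of [x] would lie in the weak, hence norm, closure
   of the union of the [W n], and yet satisfy [phi n >= e / 8] for all [n]. *)
Lemma fragmentable (U : set X) (e : R) : 0 < e -> open U -> U !=set0 ->
  exists W, [/\ open W, W !=set0, W `<=` U &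
                forall x y, W x -> W y -> `|i x - i y| <= e].
Proof.
move=> e0 oU U0; apply: contrapT => nosmall.
have big U' : open U' -> U' !=set0 -> U' `<=` U ->
    exists x y, [/\ U' x, U' y & e < `|i x - i y|].
  move=> oU' U'0 U'U; apply: contrapT => small; apply: nosmall.
  exists U'; split=> // x y U'x U'y; rewrite leNgt; apply/negP => xy.
  by apply: small; exists x, y.
(* A state holds the current open set and the span of the points chosen so far. *)
pose state := (set X * set V)%type.
pose P (s : state) := [/\ open s.1, s.1 !=set0, s.1 `<=` U & separable_subspace s.2].
have step (s : state) : exists t : state * X, P s ->
    P t.1 /\
    [/\ closure t.1.1 `<=` s.1, t.1.1 t.2, s.2 `<=` t.1.2, t.1.2 (i t.2) &
    exists phi : continuous_dual V, [/\ forall y, sval phi y <= `|y|,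
      forall w, s.2 w -> sval phi w = 0 &
      forall y, t.1.1 y -> e / 8 <= sval phi (i y)]].
  have [[oS S0 SU sW]|nP] := pselect (P s); last first.
    by have [x _] := U0; exists (s, x).
  have [|x Sx xW] := far_point sW e0 oS S0.
    by move=> U' oU' U'0 /subset_trans/(_ SU); exact: big.
  have [W0 WD WZ _] := sW.
  have [phi [phi1 phi0 phix]] := hahn_banach_distance W0 WD WZ xW.
  (* As [sval phi (i x)] is at least [e / 4], cutting at [e / 8] leaves an open set around [x]. *)
  pose T := s.1 `&` [set y | e / 8 < sval phi (i y)].
  have oT : open T.
    by apply: openI => //; exact: open_functional_gt.
  have [|T' [oT' T'x T'T]] := @open_shrink X cX hX T x oT.
    by split=> //=; lra.
  have T'S : closure T' `<=` s.1 by move=> y /T'T[].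
  exists ((T', add_line s.2 (i x)), x) => _ /=; split; last split=> //.
  - split=> //=; [by exists x| |exact: separable_add_line].
    by move=> y /subset_closure/T'S/SU.
  - exact: sub_add_line.
  - exact: add_line_gen.
  - exists phi; split=> // y /subset_closure/T'T[_ /= yphi]; exact: ltW.
have [f fP] := choice step.
pose S := fix S n : state := if n is m.+1 then (f (S m)).1 else (U, [set 0]).
have SP n : P (S n).
  elim: n => [|n IH]; first by split=> //; exact: separable_subspace0.
  by case: (fP _ IH).
pose x n := (f (S n)).2.
have [||p xp Sp] := @nested_cluster X cX (fun n => (S n.+1).1) x.
- by move=> n; case: (fP _ (SP n.+1)) => _ [].
- by move=> n; case: (fP _ (SP n)) => _ [].
have Wmono n m : (n <= m)%N -> (S n).2 `<=` (S m).2.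
  elim: m => [|m IH]; first by rewrite leqn0 => /eqP->.
  rewrite leq_eqVlt => /predU1P[<-//|/IH nm]; apply: subset_trans nm _.
  by case: (fP _ (SP m)) => _ [].
pose W := \bigcup_n (S n).2.
have W0 : W 0 by exists 0%N.
have WD u v : W u -> W v -> W (u + v).
  move=> [n _ nu] [m _ mv]; exists (maxn n m) => //.
  have [_ _ _ [_ SD _ _]] := SP (maxn n m); apply: SD.
    exact: Wmono (leq_maxl n m) _ nu.
  exact: Wmono (leq_maxr n m) _ mv.
have WZ t u : W u -> W (t *: u).
  by move=> [n _ nu]; exists n => //; have [_ _ _ [_ _ SZ _]] := SP n; exact: SZ.
have e8 : 0 < e / 8 by lra.
(* A functional separating [i p] from [W] would be positive near [p] but 0 at every [i (x n)],
   although [p] is a cluster point of [x]. *)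
have [w Ww pw] : exists2 w, W w & `|i p - w| < e / 8.
  apply: contrapT => far.
  have [|phi [phi1 phi0 phip]] := @hahn_banach_distance R V W (i p) (e / 8) W0 WD WZ.
    move=> w Ww; rewrite leNgt; apply/negP => pw; apply: far; by exists w.
  have pphi : nbhs p [set y | 0 < sval phi (i y)].
    apply: open_nbhs_nbhs; split; first exact: open_functional_gt.
    exact: lt_le_trans e8 phip.
  have xW n : W (i (x n)) by exists n.+1 => //; case: (fP _ (SP n)) => _ [].
  have X0 : (x @ \oo) [set y | sval phi (i y) = 0].
    by exists 0%N => // n _ /=; exact: phi0.
  by have [y [/= ->]] := xp _ _ X0 pphi; rewrite ltxx.
have [n _ nw] := Ww.
have [_ [_ _ _ _ [phi [phi1 phi0 phiS]]]] := fP _ (SP n).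
have := phiS p (Sp n); have := phi1 (i p - w); rewrite linearB (phi0 _ nw) subr0.
by move: pw; lra.
Qed.

End Fragmentability.

(** * Necessity *)

Section SigmaDisjointPiBase.
Variables (R : realType) (V : normedModType R) (X : topologicalType).
Hypotheses (cX : compact [set: X]) (hX : hausdorff_space X).
Variable i : X -> V.
Hypothesis i_cont :
  forall phi : continuous_dual V, continuous (fun x => sval phi (i x)).
Hypothesis i_inv : forall (O : set X) x, open O -> O x ->
  exists2 e : R, 0 < e & forall y, `|i x - i y| < e -> O y.

Lemma sigma_disjoint_pi_base : exists U_ : nat -> set (set X),
  [/\ forall n W, U_ n W -> open W /\ W !=set0,
      forall n, trivIset (U_ n) id &
      forall O, open O -> O !=set0 -> exists n W, U_ n W /\ W `<=` O].
Proof.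
pose small n := [set W : set X | [/\ open W, W !=set0 &
  forall x y, W x -> W y -> `|i x - i y| <= n.+1%:R^-1]].
have /choice[U_ U_P] n : exists U, maximal_disjoint_subcollection id U (small n).
  by have [U UP] := ex_maximal_disjoint_subcollection id (small n); exists U.
exists U_; split=> [n W UW|n|O oO O0].
- by have [/(_ W UW)[]] := U_P n.
- by have [] := U_P n.
pose G n := \bigcup_(W in U_ n) W.
have [|//|//||x Ox Gx] := @compact_baire X cX hX G O.
- move=> n; apply: bigcup_open => W UW.
  by have [/(_ W UW)[]] := U_P n.
(* A [W] missing the union would contain a small nonempty open [W'], which could be added to [U_ n]
   against maximality. *)
- move=> n W oW W0 _; apply: contrapT => WG.
  have [Usmall tU maxU] := U_P n.
  have n0 : 0 < n.+1%:R^-1 :> R by rewrite invr_gt0.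
  have [W' [oW' W'0 W'W W'small]] := fragmentable cX hX i_cont n0 oW W0.
  have disj Z : U_ n Z -> ~ (W' `&` Z !=set0).
    by move=> UZ [y [W'y Zy]]; apply: WG; exists y; split; [exact: W'W|exists Z].
  have W'U : ~ U_ n W' by move=> /disj; rewrite setIid; apply.
  apply: (maxU (W' |` U_ n)).
  + by split; [by move=> Z; right|move=> /(_ W' (or_introl erefl))].
  + by move=> Z [->|/Usmall].
  + move=> Z Z' [->|UZ] [->|UZ'] //=.
    * by move=> /(disj _ UZ').
    * by rewrite setIC => /(disj _ UZ).
    * exact: tU.
have [e e0 xO] := i_inv oO Ox.
have [n ne] : exists n, n.+1%:R^-1 < e.
  have /cvgrPdist_lt/(_ e e0)[n _ ne] := @cvg_harmonic R.
  by exists n; have := ne n (leqnn n); rewrite /= sub0r normrN ger0_norm.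
have [W UW Wx] := Gx n; exists n, W; split=> // y Wy.
have [/(_ W UW)[_ _ Wsmall] _ _] := U_P n.
by apply: xO; exact: le_lt_trans (Wsmall _ _ Wx Wy) ne.
Qed.

End SigmaDisjointPiBase.

Lemma RC_eq0 (X : topologicalType) (F : RC X) :
  (F == \bot%O) = ((F : set X) == set0).
Proof. by rewrite -val_eqE. Qed.

Lemma RC_has_sigma_disjointed_dense_subset (X : topologicalType)
    (U_ : nat -> set (set X)) :
  (forall n W, U_ n W -> open W /\ W !=set0) ->
  (forall n, trivIset (U_ n) id) ->
  (forall O, open O -> O !=set0 -> exists n W, U_ n W /\ W `<=` O) ->
  has_sigma_disjointed_dense_subset (RC X).
Proof.
move=> oU tU dU.
pose B_ n := [set F : RC X | exists2 W, U_ n W & (F : set X) = closure W].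
exists (\bigcup_n B_ n); split; last first.
  exists B_ => // n F G [W UW FW] [W' UW' GW'] FG.
  have [oW _] := oU _ _ UW; have [oW' _] := oU _ _ UW'.
  have WW' : W `&` W' = set0.
    apply: contrapT => /eqP/set0P/(tU n _ _ UW UW') eqW.
    by move/eqP: FG; apply; apply/val_inj; rewrite /= FW GW' eqW.
  apply/eqP; rewrite RC_eq0 /= -/(RC_meet F G) /= FW GW'; apply/eqP.
  (* If the intersection of the two closures had an interior point, this interior would meet [W],
     and its trace on [W] would meet [W']. *)
  rewrite -subset0 -closure0; apply: closureS => x Ix.
  have nIx := open_nbhs_nbhs (conj (@open_interior _ _) Ix).
  have [y [Wy Iy]] := (interior_subset Ix).1 _ nIx.
  have WIy : nbhs y (W `&` (closure W `&` closure W')°).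
    by apply: open_nbhs_nbhs; split; [apply: openI => //; exact: open_interior|split].
  have [z [W'z [Wz _]]] := (interior_subset Iy).2 _ WIy.
  by have : (W `&` W') z by []; rewrite WW'.
move=> F; rewrite RC_eq0 => F0.
have [||n [W [UW WF]]] := dU (F : set X)°.
- exact: open_interior.
- apply/set0P; apply: contra F0 => /eqP F0.
  by rewrite -(RC_regclosed F) F0 closure0.
have [oW W0] := oU _ _ UW.
exists (MkRC (asboolT (closure_open_regclosed oW))); split.
- by exists n => //; exists W.
- rewrite RC_eq0 /=; have [x Wx] := W0; apply/set0P; exists x; exact: subset_closure.
- rewrite RC_leE; apply/asboolP => /=; rewrite -(RC_regclosed F); exact: closureS.
Qed.

Lemma boolean_isomorphic_sigma_disjointed (d d' : Order.disp_t)
    (A : ctbDistrLatticeType d) (A' : ctbDistrLatticeType d') :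
  boolean_isomorphic A A' -> has_sigma_disjointed_dense_subset A' ->
  has_sigma_disjointed_dense_subset A.
Proof.
move=> [f [[g fK gK] fI _ fC]] [B [dB [B_ BB_ tB]]].
have f0 : f \bot%O = \bot%O by rewrite -(meetxC \bot%O) fI fC meetxC.
have f_eq0 a : (f a == \bot%O) = (a == \bot%O).
  by rewrite -f0 (inj_eq (can_inj fK)).
exists (f @^-1` B); split=> [a|].
  rewrite -f_eq0 => /dB[b [Bb b0 ba]]; exists (g b); rewrite -f_eq0 gK /=.
  split=> //; first by rewrite /= gK.
  by rewrite leEmeet -(inj_eq (can_inj fK)) fI gK -leEmeet.
exists (fun n => f @^-1` B_ n); first by rewrite BB_ preimage_bigcup.
move=> n a b Ba Bb ab; apply/eqP; rewrite -f_eq0 fI; apply/eqP.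
by apply: tB Ba Bb _; rewrite (inj_eq (can_inj fK)).
Qed.

(** * The weak topology and its comparison with the norm topology *)

Section WeakTopology.
Variables (R : realType) (V : normedModType R).

Lemma weak_functional_continuous (phi : continuous_dual V) :
  continuous (sval phi : weak_space V -> R^o).
Proof.
move=> v; have /cvg_sup/(_ phi) := @cvg_refl _ (nbhs (v : weak_space V)).
move=> vphi A Aphi; apply: vphi; exact: (@initial_continuous _ _ (sval phi)).
Qed.

Lemma cvg_weak (F : set_system V) (v : V) : Filter F ->
  (forall phi : continuous_dual V, (sval phi : V -> R^o) @ F --> sval phi v) ->
  F --> (v : weak_space V).
Proof.
move=> FF Fphi; apply/cvg_sup => phi A /=.
rewrite /nbhs /= => -[_ [[B oB <-] Bv BA]].
by apply: filterS BA _; apply: Fphi; exact: open_nbhs_nbhs.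
Qed.

(** Weakly open sets are norm open; as both topologies live on the same carrier, this is put as
    convergence of the norm neighbourhood filter. *)
Lemma norm_cvg_weak (v : V) : nbhs v --> (v : weak_space V).
Proof. by apply: cvg_weak => phi; exact: (svalP phi). Qed.

End WeakTopology.

Lemma Eberlein_has_sigma_disjointed (R : realType) (X : topologicalType) :
  Eberlein_compact R X -> has_sigma_disjointed_dense_subset (RC X).
Proof.
move=> [cX hX [V [K [cK [f [g [fK gK f_cont g_cont]]]]]]].
pose i x : V := set_val (f x).
have i_cont (phi : continuous_dual V) : continuous (fun x => sval phi (i x)).
  move=> x; apply: (@continuous_comp X (weak_space V) R^o i (sval phi)).
    apply: (@continuous_comp X K (weak_space V) f set_val); first exact: f_cont.
    exact: initial_continuous.
  exact: weak_functional_continuous.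
have [|U_ [oU tU dU]] := sigma_disjoint_pi_base cX hX i_cont.
  move=> O x oO Ox.
  (* In the subspace topology of [K], the image of [O] is the trace of a weakly open, hence norm
     open, set [W]. *)
  have [W oW WO] : open (g @^-1` O) by apply: open_comp.
  have WP y : W (i y) <-> O y.
    have -> : O y = (g @^-1` O) (f y) by rewrite /preimage /= fK.
    by rewrite -WO.
  have : nbhs (i x : V) W.
    by apply: norm_cvg_weak; apply: open_nbhs_nbhs; split=> //; exact/WP.
  move=> /nbhs_normP[e /= e0 eW]; exists e => // y xy.
  by apply/WP/eW.
exact: RC_has_sigma_disjointed_dense_subset oU tU dU.
Qed.

(** * The Stone space *)

Section BooleanLemmas.
Variables (d d' : Order.disp_t).
Variables (A : ctbDistrLatticeType d) (A' : ctbDistrLatticeType d').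

(** Meets, joins and complements are determined by the order; bounds in [A'] are compared by pulling
    them back along [g]. *)
Lemma boolean_isomorphic_le (f : A -> A') :
  {mono f : x y / (x <= y)%O} -> (forall b, exists a, f a = b) ->
  boolean_isomorphic A A'.
Proof.
move=> fle /choice[g gK].
have fI : {morph f : x y / (x `&` y)%O}.
  move=> x y; apply/le_anti; rewrite lexI !fle leIl leIr /=.
  by rewrite -[X in (X <= _)%O]gK fle lexI -!fle gK leIl leIr.
have fU : {morph f : x y / (x `|` y)%O}.
  move=> x y; apply/le_anti; rewrite leUx !fle leUl leUr andbT.
  by rewrite -[X in (_ <= X)%O]gK fle leUx -!fle gK leUl leUr.
have f0 : f \bot%O = \bot%O by apply/le_anti; rewrite le0x -(gK \bot%O) fle le0x.
have f1 : f \top%O = \top%O by apply/le_anti; rewrite lex1 -(gK \top%O) fle lex1.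
exists f; split=> //.
  by exists g => // x; apply: (inc_inj fle); rewrite gK.
move=> x; apply/le_anti; rewrite -disj_leC -fI meetCx f0 eqxx /=.
by rewrite -[f (~` x)%O]complK -disj_leC -complU -fU joinxC f1 compl1.
Qed.

Lemma le_compl_eq0 (a c : A) : (a <= c)%O -> (a <= ~` c)%O -> a = \bot%O.
Proof. by move=> ac acC; apply/eqP; rewrite -lex0 -(meetxC c) lexI ac. Qed.

End BooleanLemmas.

(* The Stone space of the subalgebra of [A] generated by the range of [e], an
   ultrafilter being coded by the set of the [g] such that it contains [e g]. *)
Section StoneSpace.
Variables (d : Order.disp_t) (A : ctbDistrLatticeType d) (G : choiceType).
Variable e : G -> A.
Implicit Types (c : A) (s t : seq G).

Definition literal (b : G -> bool) (g : G) : A := if b g then e g else (~` e g)%O.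

(** The finite joins of these meets form the subalgebra generated by the range of [e]. *)
Definition cell (b : G -> bool) (s : seq G) : A :=
  foldr (fun g a => (literal b g `&` a)%O) \top%O s.

Lemma le_cellP (b : G -> bool) s c :
  reflect (forall g, g \in s -> (c <= literal b g)%O) (c <= cell b s)%O.
Proof.
elim: s => [|g s IH] /=; first by rewrite lex1; constructor.
rewrite lexI; apply: (iffP andP) => [[cg /IH cs] h|cs].
  by rewrite inE => /predU1P[->|/cs].
split; first by apply: cs; rewrite mem_head.
by apply/IH => h hs; apply: cs; rewrite inE hs orbT.
Qed.

Lemma cell_le (b : G -> bool) s t : {subset s <= t} -> (cell b t <= cell b s)%O.
Proof. by move=> st; apply/le_cellP => g /st; apply/le_cellP. Qed.

Lemma cell_cat_le (b : G -> bool) s t :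
  (cell b (s ++ t) <= cell b s)%O /\ (cell b (s ++ t) <= cell b t)%O.
Proof. by split; apply: cell_le => g gs; rewrite mem_cat gs ?orbT. Qed.

Lemma eq_cell (b b' : G -> bool) s :
  (forall g, g \in s -> b g = b' g) -> cell b s = cell b' s.
Proof.
elim: s => //= g s IH bb'; rewrite /literal bb' ?mem_head// IH// => h hs.
by rewrite bb'// inE hs orbT.
Qed.

(** That no cell vanishes is the finite intersection property; since [b] picks one of [e g] and its
    complement for each [g], the picked literals generate an ultrafilter of the subalgebra. *)
Definition stone := {b : G -> bool | forall s, cell b s != \bot%O}.

HB.instance Definition _ := gen_eqMixin stone.
HB.instance Definition _ := gen_choiceMixin stone.

(** Basic neighbourhoods for the topology induced from a product of discrete copies of [bool]. *)
Definition agree (x : stone) s : set stone :=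
  [set y | forall g, g \in s -> sval y g = sval x g].

HB.instance Definition _ := hasNbhs.Build stone
  (fun x => filter_from [set: seq G] (agree x)).

Lemma stone_nbhs_filter (x : stone) : ProperFilter (nbhs x).
Proof.
apply: filter_from_proper; last by move=> s _; exists x.
apply: filter_from_filter; first by exists [::].
move=> s t _ _; exists (s ++ t) => // y xy.
by split=> g gs; apply: xy; rewrite mem_cat gs ?orbT.
Qed.

Lemma stone_nbhs_singleton (x : stone) (U : set stone) : nbhs x U -> U x.
Proof. by move=> [s _]; apply. Qed.

Lemma stone_nbhs_nbhs (x : stone) (U : set stone) :
  nbhs x U -> nbhs x (nbhs^~ U).
Proof.
move=> [s _ sU]; exists s => // y xy; exists s => // z yz; apply: sU => g gs.
by rewrite yz// xy.
Qed.

HB.instance Definition _ := Nbhs_isNbhsTopological.Build stone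
  stone_nbhs_filter stone_nbhs_singleton stone_nbhs_nbhs.

Lemma nbhs_stone (x : stone) (U : set stone) :
  nbhs x U <-> exists s, agree x s `<=` U.
Proof. by split=> [[s _ sU]|[s sU]]; exists s. Qed.

Lemma open_agree (x : stone) s : open (agree x s).
Proof.
rewrite openE => y xy; apply/nbhs_stone; exists s => z yz g gs.
by rewrite yz// xy.
Qed.

Lemma closed_agree (x : stone) s : closed (agree x s).
Proof.
move=> y cy g gs; have [|z [xz yz]] := cy (agree y [:: g]).
  by apply/nbhs_stone; exists [:: g].
by rewrite -xz// -yz// inE.
Qed.

Lemma stone_has_clopen_basis : has_clopen_basis stone.
Proof.
exists [set U | exists x s, U = agree x s]; split; last first.
  by move=> _ [x [s ->]]; split; [exact: open_agree|exact: closed_agree].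
split=> [_ [x [s ->]]|x U /nbhs_stone[s sU]]; first exact: open_agree.
by exists (agree x s) => //; split=> //; exists x, s.
Qed.

Lemma stone_inj (x y : stone) : sval x = sval y -> x = y.
Proof. by case: x y => [b bP] [b' b'P] /= bb'; exact: eq_exist. Qed.

Lemma stone_hausdorff : hausdorff_space stone.
Proof.
move=> x y xy; apply/stone_inj/funext => g.
have [||z [xz yz]] := xy (agree x [:: g]) (agree y [:: g]).
- by apply/nbhs_stone; exists [:: g].
- by apply/nbhs_stone; exists [:: g].
- by rewrite -xz ?inE// yz ?inE.
Qed.

(** Along an ultrafilter every coordinate is eventually constant. Any finitely many coordinates of
    the limit are those of an actual point, so its cells are nonzero. *)
Lemma stone_compact : compact [set: stone].
Proof.
rewrite compact_ultra => F FU _.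
pose b g : bool := `[< F [set x | sval x g = true] >].
have Fb s : F [set x | forall g, g \in s -> sval x g = b g].
  elim: s => [|g s IH]; first by apply: filterS filterT.
  have Fg : F [set x | sval x g = b g].
    rewrite /b; case: asboolP => // nF.
    have [//|] := in_ultra_setVsetC [set x | sval x g = true] FU.
    by apply: filterS => x /= /negP/negbTE.
  apply: filterS (filterI Fg IH) => x /= [xg xs] h.
  by rewrite inE => /predU1P[->|/xs].
have bP s : cell b s != \bot%O.
  have [x xb] := filter_ex (Fb s).
  by rewrite -(eq_cell xb); exact: (svalP x).
exists (exist _ b bP); split=> // U /nbhs_stone[s sU].
by apply: filterS sU (Fb s).
Qed.

(** The ultrafilter [F] consists of subsets of [A]. It contains each [D s], the nonzero elements
    below [c] that decide every [e g] for [g] in [s], and [b g] records the decision made along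
    [F]. *)
Lemma stone_point c : c != \bot%O ->
  exists x : stone, forall s, (cell (sval x) s `&` c)%O != \bot%O.
Proof.
move=> c0.
pose D s := [set a | [/\ a != \bot%O, (a <= c)%O &
  forall g, g \in s -> (a <= e g)%O \/ (a <= ~` e g)%O]].
have D0 s : D s !=set0.
  elim: s => [|g s [a [a0 ac as_]]]; first by exists c.
  have [aeg|aeg] := eqVneq (a `&` e g)%O \bot%O.
    exists a; split=> // h; rewrite inE => /predU1P[->|/as_//].
    by right; rewrite -disj_leC aeg.
  exists (a `&` e g)%O; split=> //; first by rewrite leIxl.
  move=> h; rewrite inE => /predU1P[->|/as_[]]; first by left; rewrite leIr.
    by left; rewrite leIxl.
  by right; rewrite leIxl.
have FD : ProperFilter (filter_from [set: seq G] D).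
  apply: filter_from_proper; last by move=> s _.
  apply: filter_from_filter; first by exists [::].
  move=> s t _ _; exists (s ++ t) => // a [a0 ac ast].
  by split; split=> // g gs; apply: ast; rewrite mem_cat gs ?orbT.
have [F [FU DF]] := ultraFilterLemma FD.
pose b g : bool := `[< F [set a | (a <= e g)%O] >].
have Fb s : F [set a | (a <= cell b s)%O].
  elim: s => [|g s IH]; first by apply: filterS filterT => a _ /=; rewrite lex1.
  have Fg : F [set a | (a <= literal b g)%O].
    rewrite /literal /b; case: asboolP => // nF.
    have [//|Fn] := in_ultra_setVsetC [set a | (a <= e g)%O] FU.
    have Fd : F (D [:: g]) by apply: DF; exists [:: g].
    apply: filterS (filterI Fn Fd) => a [/= na [_ _ /(_ g (mem_head _ _))[]//]].
  by apply: filterS (filterI Fg IH) => a /= [ag as_]; rewrite lexI ag.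
have bc s : (cell b s `&` c)%O != \bot%O.
  have Fd : F (D [::]) by apply: DF; exists [::].
  have [a [/= ab [a0 ac _]]] := filter_ex (filterI (Fb s) Fd).
  by apply: contra_neq a0 => bc0; apply/eqP; rewrite -lex0 -bc0 lexI ab.
have bP s : cell b s != \bot%O.
  by apply: contra_neq (bc s) => ->; rewrite meet0x.
by exists (exist _ b bP).
Qed.

Hypothesis e_dense : forall c, c != \bot%O -> exists g, e g != \bot%O /\ (e g <= c)%O.

(** The ultrafilters with a member below [c]. When [c] is outside the subalgebra this open set need
    not be closed; its closure represents [c]. *)
Definition inner c : set stone := [set x | exists s, (cell (sval x) s <= c)%O].

Lemma inner_open c : open (inner c).
Proof.
rewrite openE => x [s sc]; apply/nbhs_stone; exists s => y xy.
by exists s; rewrite (eq_cell xy).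
Qed.

Lemma stone_point_gen g : e g != \bot%O -> exists x : stone, sval x g.
Proof.
move=> /stone_point[x xg]; exists x; apply/negPn/negP => /negbTE nxg.
by have := xg [:: g]; rewrite /= /literal nxg meetx1 meetCx eqxx.
Qed.

(** The opposite literal at some [h] in [s] would make the cell of [y] on [[:: g; h]] vanish. *)
Lemma gen_agree (x y : stone) g s :
  (e g <= cell (sval x) s)%O -> sval y g -> agree x s y.
Proof.
move=> /le_cellP gs yg h /gs; have := svalP y [:: g; h].
rewrite /= /literal yg meetx1; case: (sval x h); case: (sval y h) => //.
  by rewrite disj_leC complK => /[swap] ->.
by rewrite disj_leC => /[swap] ->.
Qed.

Lemma gen_inner (x : stone) g : sval x g -> inner (e g) x.
Proof. by move=> xg; exists [:: g]; rewrite /= /literal xg leIl. Qed.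

Lemma inner_le c c' : (c <= c')%O -> inner c `<=` inner c'.
Proof. by move=> cc' x [s sc]; exists s; exact: le_trans sc cc'. Qed.

Lemma inner_disjoint c (x : stone) : inner c x -> ~ inner (~` c)%O x.
Proof.
move=> [s sc] [t tc]; have := svalP x (s ++ t); have [bs bt] := cell_cat_le (sval x) s t.
move/eqP; apply; exact: le_compl_eq0 (le_trans bs sc) (le_trans bt tc).
Qed.

(** If [x] is outside the right-hand open set, each cell of [x] meets [c]; density puts a generator
    below the meet, and its points are in [inner c] and close to [x]. *)
Lemma closure_inner c : closure (inner c) = ~` inner (~` c)%O.
Proof.
apply/seteqP; split=> x.
  move=> cx nx; have [|y [cy ny]] := cx (inner (~` c)%O).
    by apply: open_nbhs_nbhs; split=> //; exact: inner_open.
  exact: inner_disjoint cy ny.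
move=> nx U /nbhs_stone[s sU].
have : (cell (sval x) s `&` c)%O != \bot%O.
  by apply/negP; rewrite disj_leC => sc; apply: nx; exists s.
move=> /e_dense[g [g0]]; rewrite lexI => /andP[gs gc].
have [y yg] := stone_point_gen g0; exists y; split.
  exact: inner_le gc _ (gen_inner yg).
by apply: sU; exact: gen_agree yg.
Qed.

Definition RC_of c : RC stone :=
  MkRC (asboolT (closure_open_regclosed (@inner_open c))).

(** If [c] is not below [c'], a generator lies below [c] and the complement of [c']; its points
    separate the two closures. *)
Lemma RC_of_le : {mono RC_of : c c' / (c <= c')%O}.
Proof.
move=> c c'; rewrite RC_leE; apply/asboolP/idP => /= [cc'|/inner_le]; last exact: closureS.
rewrite -[c']complK -disj_leC; apply: contrapT => /negP/e_dense.
move=> [g [g0]]; rewrite lexI => /andP[gc gc']; have [x xg] := stone_point_gen g0.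
have : closure (inner c') x.
  apply: cc'; apply: subset_closure; exact: inner_le gc _ (gen_inner xg).
rewrite closure_inner; apply; exact: inner_le gc' _ (gen_inner xg).
Qed.

(** Completeness provides [c] as the join of the generators whose points all lie in [F]. *)
Lemma RC_of_surj (F : RC stone) : complete_algebra A -> exists c, RC_of c = F.
Proof.
move=> cA; pose S := [set a | exists2 g, a = e g & [set x : stone | sval x g] `<=` F].
have [c [cub club]] := cA S; exists c; apply/val_inj => /=; apply/seteqP; split.
  rewrite [X in _ `<=` X](closure_id _).1; last exact: RC_closed.
  (* Outside [F], some generator below [c] has all its points off [F], so it is disjoint from every
     member of [S] and hence from [c]. *)
  apply: closureS => x [s sc]; apply: contrapT => nFx.
  have /nbhs_stone[t tF] : nbhs x (~` (F : set _)).
    by apply: open_nbhs_nbhs; split=> //; apply: closed_openC; exact: RC_closed.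
  have [bs bt] := cell_cat_le (sval x) s t.
  have [g [g0 gst]] := e_dense (svalP x (s ++ t)).
  have cg : (c <= ~` e g)%O.
    apply: club => _ [h -> hF]; rewrite -disj_leC.
    apply: contrapT => /negP/stone_point[y yhg].
    have yh : sval y h.
      apply: contraT => nyh; have := yhg [:: h].
      by rewrite /= /literal (negbTE nyh) meetx1 meetA meetCx meet0x eqxx.
    have yg : sval y g.
      apply: contraT => nyg; have := yhg [:: g].
      by rewrite /= /literal (negbTE nyg) meetx1 meetCA meetCx meetx0 eqxx.
    have := hF _ yh; apply: tF; apply: gen_agree yg; exact: le_trans gst bt.
  move/eqP: g0; apply; apply: (le_compl_eq0 (lexx _)).
  exact: le_trans (le_trans gst (le_trans bs sc)) cg.
rewrite -{1}(RC_regclosed F) [X in _ `<=` X](closure_id _).1; last exact: closed_closure.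
(* Otherwise a generator with all its points in [F], hence below [c], would also be below the
   complement of [c]. *)
apply: closureS => x /nbhs_stone[s sF]; rewrite closure_inner => -[t tc].
have [bs bt] := cell_cat_le (sval x) s t.
have [g [g0 gst]] := e_dense (svalP x (s ++ t)).
have gc : (e g <= c)%O.
  apply: cub; exists g => // y yg; apply: sF; apply: gen_agree yg.
  exact: le_trans gst bs.
move/eqP: g0; apply; exact: le_compl_eq0 gc (le_trans gst (le_trans bt tc)).
Qed.

Lemma stone_boolean_isomorphic : complete_algebra A ->
  boolean_isomorphic A (RC stone).
Proof.
move=> cA; apply: (boolean_isomorphic_le RC_of_le) => F; exact: RC_of_surj.
Qed.

End StoneSpace.

(** * The space of bounded functions *)

Section BoundedFunctions.
Variables (R : realType) (G : Type).

Definition bounded_pred : {pred G -> R^o} :=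
  [pred f : G -> R^o | `[< exists M : R, forall g, `|f g| <= M >]].

Lemma bounded_predP (f : G -> R^o) :
  reflect (exists M : R, forall g, `|f g| <= M) (f \in bounded_pred).
Proof. exact: asboolP. Qed.

Lemma bounded_submod_closed : submod_closed bounded_pred.
Proof.
split; first by apply/bounded_predP; exists 0 => g; rewrite normr0.
move=> a u v /bounded_predP[M uM] /bounded_predP[N vN].
apply/bounded_predP; exists (`|a| * M + N) => g.
by rewrite (le_trans (ler_normD _ _))// lerD// normrM ler_wpM2l.
Qed.

HB.instance Definition _ := GRing.isSubmodClosed.Build R (G -> R^o) bounded_pred
  bounded_submod_closed.

Record linfty := MkLinfty {
  linfty_fun :> G -> R^o; linfty_bounded : linfty_fun \in bounded_pred }.

HB.instance Definition _ := [isSub for linfty_fun].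
HB.instance Definition _ := [Choice of linfty by <:].
HB.instance Definition _ := [SubChoice_isSubLmodule of linfty by <:].

Implicit Types u v : linfty.

Lemma linfty_ext u v : (forall g, u g = v g) -> u = v.
Proof. by move=> uv; apply/val_inj/funext. Qed.

Lemma linftyD u v g : (u + v) g = u g + v g. Proof. by []. Qed.
Lemma linftyB u v g : (u - v) g = u g - v g. Proof. by []. Qed.
Lemma linftyZ (a : R) u g : (a *: u) g = a * u g. Proof. by []. Qed.

Definition linfty_norm u : R := sup (range (fun g => `|u g|)).

Lemma le_linfty_norm u g : `|u g| <= linfty_norm u.
Proof.
apply: ub_le_sup; last by exists g.
have /bounded_predP[M uM] := linfty_bounded u.
by exists M => _ [h _ <-].
Qed.

(** An empty [G] gives the supremum of the empty set, whose default value is 0. *)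
Lemma linfty_norm_empty u : ~ inhabited G -> linfty_norm u = 0.
Proof.
move=> G0; rewrite /linfty_norm [X in sup X](_ : _ = set0) ?sup0//.
by apply/seteqP; split=> // y [g _ _]; apply: G0.
Qed.

Lemma linfty_norm_le u (M : R) :
  0 <= M -> (forall g, `|u g| <= M) -> linfty_norm u <= M.
Proof.
move=> M0 uM; have [[g]|G0] := pselect (inhabited G).
  apply: ge_sup; first by exists `|u g|, g.
  by move=> _ [h _ <-].
by rewrite linfty_norm_empty.
Qed.

Lemma linfty_norm_ge0 u : 0 <= linfty_norm u.
Proof.
have [[g]|G0] := pselect (inhabited G).
  exact: le_trans (le_linfty_norm u g).
by rewrite linfty_norm_empty.
Qed.

Lemma linfty_normD u v : linfty_norm (u + v) <= linfty_norm u + linfty_norm v.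
Proof.
apply: linfty_norm_le => [|g]; first by rewrite addr_ge0 ?linfty_norm_ge0.
by rewrite linftyD (le_trans (ler_normD _ _))// lerD// le_linfty_norm.
Qed.

Lemma linfty_normZ (a : R) u : linfty_norm (a *: u) = `|a| * linfty_norm u.
Proof.
have normZ_le (b : R) v : linfty_norm (b *: v) <= `|b| * linfty_norm v.
  apply: linfty_norm_le => [|g]; first by rewrite mulr_ge0 ?linfty_norm_ge0.
  by rewrite linftyZ normrM ler_wpM2l// le_linfty_norm.
have [->|a0] := eqVneq a 0.
  rewrite scale0r normr0 mul0r; apply/le_anti; rewrite linfty_norm_ge0 andbT.
  by apply: linfty_norm_le => // g; rewrite normr0.
apply/le_anti; rewrite normZ_le /= -ler_pdivlMl ?normr_gt0// -normfV.
by rewrite -{1}[u](scalerK a0) normZ_le.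
Qed.

Lemma linfty_norm0_eq0 u : linfty_norm u = 0 -> u = 0.
Proof.
move=> u0; apply/val_inj/funext => g /=; apply/normr0_eq0/le_anti.
by rewrite normr_ge0 andbT -u0 le_linfty_norm.
Qed.

HB.instance Definition _ := Lmodule_isNormed.Build R linfty
  linfty_normD linfty_normZ linfty_norm0_eq0.

Lemma linfty_normE u : `|u| = linfty_norm u. Proof. by []. Qed.

Lemma linfty_complete (F : set_system linfty) :
  ProperFilter F -> cauchy F -> cvg F.
Proof.
move=> FF /cauchyP Fc.
have ball_near (c : linfty) e g : ball c e `<=` [set u : linfty | `|c g - u g| < e].
  move=> u; rewrite -ball_normE /=; apply: le_lt_trans.
  exact: le_linfty_norm (c - u) g.
have evcvg g : cvg ((fun u : linfty => u g : R) @ F).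
  apply/cauchy_cvgP; apply: cauchy_exP => e e0.
  have [c Fce] := Fc e e0; exists (c g : R).
  suff : F [set u : linfty | ball (c g : R) e (u g)] by [].
  by apply: filterS Fce => u cu; rewrite /= -ball_normE; exact: ball_near cu.
pose l g : R^o := lim ((fun u : linfty => u g : R) @ F).
(* A ball belonging to [F] bounds the distance from its centre to the pointwise limit [l] uniformly
   in [g]; both boundedness of [l] and norm convergence follow. *)
have lP (c : linfty) (e : R) : 0 < e -> F (ball c e) -> forall g, `|c g - l g| <= e.
  move=> e0 Fce g.
  have : (fun u : linfty => `|c g - u g|) @ F --> `|c g - l g|.
    by apply: cvg_norm; apply: cvgB; [exact: cvg_cst|exact: evcvg].
  move=> /(@cvgr_to_le _ _ _ _ _ _ e); apply.
  by apply: filterS Fce => u /(ball_near _ _ g)/ltW.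
have [c1 Fc1] := Fc 1 ltr01.
have l_bounded : l \in bounded_pred.
  apply/bounded_predP; exists (`|c1| + 1) => g.
  have := lP _ _ ltr01 Fc1 g; have := le_linfty_norm c1 g; rewrite -linfty_normE.
  have := ler_normB (c1 g) (c1 g - l g).
  by rewrite opprB addrC subrK; lra.
apply/cvg_ex; exists (MkLinfty l_bounded); apply/cvgrPdist_lt => e e0.
have e2 : 0 < e / 2 by rewrite divr_gt0.
have [c Fce] := Fc _ e2.
have lc := lP c _ e2 Fce; apply: filterS Fce => u; rewrite -ball_normE /= => cu.
apply: le_lt_trans (ler_distD c _ _) _; rewrite [ltRHS]splitr; apply: ler_ltD => //.
apply: linfty_norm_le => [|g]; first exact: ltW.
by have := lc g; rewrite distrC.
Qed.

HB.instance Definition _ := Uniform_isComplete.Build linfty linfty_complete.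

End BoundedFunctions.

(** * Continuous functionals on the space of bounded functions *)

Section LinftyDual.
Variables (R : realType) (G : choiceType).

Lemma unit_vector_bounded (h : G) :
  (fun g : G => (g == h)%:R : R^o) \in @bounded_pred R G.
Proof.
by apply/bounded_predP; exists 1 => g; case: eqVneq => _; rewrite ?normr1 ?normr0.
Qed.

Definition unit_vector (h : G) : linfty R G := MkLinfty (unit_vector_bounded h).

Lemma continuous_dual_bounded (V : normedModType R) (phi : continuous_dual V) :
  exists2 M : R, 0 < M & forall v, `|sval phi v| <= M * `|v|.
Proof.
have /linear_boundedP/pinfty_ex_gt0[M M0 phiM] :
    bounded_near (sval phi) (nbhs (0 : V)).
  by apply: continuous_linear_bounded; exact: (svalP phi).
by exists M.
Qed.

(** Makes coordinates weakly continuous, as the inverse of the embedding of the Stone space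
    requires. *)
Lemma evaluation_functional (g : G) :
  exists phi : continuous_dual (linfty R G), forall v, sval phi v = v g.
Proof.
have ev_linear : linear_for *:%R (fun v : linfty R G => v g : R^o) by [].
pose ev : {linear linfty R G -> R^o} := HB.pack (fun v : linfty R G => v g : R^o)
  (GRing.isLinear.Build R (linfty R G) R^o *:%R _ ev_linear).
have ev_cont : continuous ev.
  apply: linear_le_norm_continuous => v.
  exact: le_trans (ler_norm _) (le_linfty_norm v g).
by exists (exist _ ev ev_cont).
Qed.

Lemma unit_vector_sum (s : seq G) (c : G -> R) g :
  (\sum_(h <- s) c h *: unit_vector h : linfty R G) g =
  \sum_(h <- s) c h * (g == h)%:R.
Proof. by elim/big_ind2: _ => // u a v b /= <- <-. Qed.

(* Testing [phi] against the signed sums of unit vectors, which have norm at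
   most 1, bounds the number of unit vectors on which [phi] is large. *)
Lemma finite_large_coordinates (phi : continuous_dual (linfty R G)) (e : R) :
  0 < e -> finite_set [set g | e <= `|sval phi (unit_vector g)|].
Proof.
move=> e0; have [M M0 phiM] := continuous_dual_bounded phi.
(* More than [M / e] such vectors would give a signed sum [u] of norm at most 1 with [sval phi u]
   above [M]. *)
apply: contrapT => /(infinite_set_fset (Num.truncn (M / e)).+1)[B Be sB].
pose s := finmap.enum_fset B.
have s_uniq : uniq s by exact: finmap.fset_uniq.
have s_large h : h \in s -> e <= `|sval phi (unit_vector h)| by exact: Be.
pose c h := Num.sg (sval phi (unit_vector h)) : R.
pose u : linfty R G := \sum_(h <- s) c h *: unit_vector h.
have u1 : `|u| <= 1.
  apply: linfty_norm_le => // g; rewrite unit_vector_sum.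
  have [gs|gs] := boolP (g \in s).
    rewrite (bigD1_seq g)//= eqxx mulr1 big1 ?addr0.
      by rewrite normr_sg; case: eqP.
    by move=> h hg; rewrite eq_sym (negbTE hg) mulr0.
  rewrite big_seq big1 ?normr0// => h hs.
  by case: eqVneq gs => [->|_ _]; rewrite ?hs// mulr0.
have : (size s)%:R * e <= sval phi u.
  have sum_ge (t : seq G) : {subset t <= s} ->
      (size t)%:R * e <= \sum_(h <- t) `|sval phi (unit_vector h)|.
    elim: t => [|h t IH] ts; first by rewrite big_nil mul0r.
    rewrite big_cons -natr1 mulrDl mul1r addrC lerD//.
      by apply: s_large; rewrite ts ?mem_head.
    by apply: IH => k kt; rewrite ts// inE kt orbT.
  rewrite /u linear_sum /= (eq_bigr (fun h => `|sval phi (unit_vector h)|)).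
    exact: sum_ge.
  by move=> h _; rewrite linearZ normrEsg.
have := phiM u; have := ler_norm (sval phi u).
have : M / e < (size s)%:R.
  by apply: lt_le_trans (truncnS_gt _) _; rewrite ler_nat.
rewrite ltr_pdivrMr//; have : M * `|u| <= M by rewrite ler_piMr// ltW.
lra.
Qed.

End LinftyDual.

(** * Sufficiency *)

Section StoneEberlein.
Variables (R : realType) (d : Order.disp_t) (A : ctbDistrLatticeType d).
Variables (G : choiceType) (e : G -> A) (level : G -> nat).
Hypothesis e_disjoint : forall g h,
  level g = level h -> g != h -> (e g `&` e h)%O = \bot%O.

Local Notation X := (stone e).
Local Notation V := (linfty R G).

Lemma level_inj (x : X) g h : sval x g -> sval x h -> level g = level h -> g = h.
Proof.
move=> xg xh lgh; apply/eqP; apply: contraT => /(e_disjoint lgh) gh.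
by have := svalP x [:: g; h]; rewrite /= /literal xg xh meetx1 gh eqxx.
Qed.

Lemma tail_bounded (n : nat) (x : X) :
  (fun g => (if sval x g && (n <= level g)%N then 2^-1 ^+ level g else 0) : R^o)
    \in @bounded_pred R G.
Proof.
apply/bounded_predP; exists 1 => g; case: ifP => _; rewrite ?normr0//.
by rewrite ger0_norm ?exprn_ge0 ?exprn_ile1 ?invr_ge0 ?invf_le1 ?ler1n.
Qed.

(* [tail 0] is the embedding of the Stone space, and [tail n x - tail n.+1 x] is
   a multiple of a single unit vector by [level_inj]. *)
Definition tail n x : V := MkLinfty (tail_bounded n x).

Lemma tailE n x g :
  tail n x g = if sval x g && (n <= level g)%N then 2^-1 ^+ level g else 0.
Proof. by []. Qed.

Lemma norm_tail n x : `|tail n x| <= 2^-1 ^+ n.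
Proof.
have half0 : 0 <= 2^-1 :> R by rewrite invr_ge0.
apply: linfty_norm_le => [|g]; first exact: exprn_ge0.
rewrite tailE; case: ifP => [/andP[_ ng]|_]; last by rewrite normr0 exprn_ge0.
by rewrite ger0_norm ?exprn_ge0// ler_wiXn2l// invf_le1 ?ler1n.
Qed.

Lemma layer_eq n (x : X) g : sval x g -> level g = n ->
  tail n x - tail n.+1 x = 2^-1 ^+ n *: unit_vector R g.
Proof.
move=> xg gn; apply: linfty_ext => h; rewrite linftyB linftyZ !tailE /=.
have [->|hg] := eqVneq h g; first by rewrite xg gn leqnn ltnn /= subr0 mulr1.
rewrite mulr0; have [xh|] := boolP (sval x h); last by rewrite subr0.
rewrite leq_eqVlt; have [nh|_] /= := eqVneq n (level h); last by rewrite subrr.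
by move: hg; rewrite (level_inj xh xg) ?eqxx// -nh.
Qed.

Lemma layer_eq0 n (x : X) : (forall g, sval x g -> level g <> n) ->
  tail n x - tail n.+1 x = 0.
Proof.
move=> xn; apply: linfty_ext => h; rewrite linftyB !tailE /=.
have [xh|] := boolP (sval x h); last by rewrite subr0.
rewrite leq_eqVlt; have [nh|_] /= := eqVneq n (level h); last by rewrite subrr.
by case: (xn h xh).
Qed.

(** Let [x] agree with [x0] on the finite set of unit vectors where [phi] is at least [eps / 2] in
    absolute value. Either both points contain the same generator of level [n] in this set and the
    layers coincide, or both values are below [eps / 2]. *)
Lemma layer_functional_continuous (phi : continuous_dual V) n :
  continuous (fun x : X => sval phi (tail n x - tail n.+1 x) : R).
Proof.
move=> x0; apply/(@cvgrPdist_lt _ _ _ (nbhs x0) (nbhs_filter x0)) => eps eps0.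
apply/nbhs_stone.
have eps2 : 0 < eps / 2 by rewrite divr_gt0.
have /finite_seqP[s sE] := finite_large_coordinates phi eps2.
exists s => x xx0.
have layer_small (y : X) : (exists g, [/\ g \in s, sval y g & level g = n]) \/
    `|sval phi (tail n y - tail n.+1 y)| < eps / 2.
  have [[g [yg gn]]|ny] := pselect (exists g, sval y g /\ level g = n); last first.
    right; rewrite layer_eq0 ?linear0 ?normr0// => g yg gn.
    by apply: ny; exists g.
  have [gs|gs] := boolP (g \in s); first by left; exists g.
  right; rewrite (layer_eq yg gn) linearZ normrM ger0_norm ?exprn_ge0 ?invr_ge0//.
  have : `|sval phi (unit_vector R g)| < eps / 2.
    rewrite ltNge; apply: contra gs => large.
    by have : [set` s] g by rewrite -sE.
  apply: le_lt_trans; rewrite ler_piMl// exprn_ile1 ?invr_ge0// invf_le1 ?ler1n//.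
rewrite /=; have [[g [gs x0g gn]]|small0] := layer_small x0.
  have xg : sval x g by rewrite xx0.
  by rewrite (layer_eq xg gn) (layer_eq x0g gn) subrr normr0.
have [[g [gs xg gn]]|small] := layer_small x.
  have x0g : sval x0 g by rewrite -xx0.
  by rewrite (layer_eq xg gn) (layer_eq x0g gn) subrr normr0.
by rewrite (le_lt_trans (ler_normB _ _))// [ltRHS]splitr ltrD.
Qed.

(** A uniform limit of finite sums of layers: [phi] is at most [M * 2^-1 ^+ n] on the remainder
    [tail n x]. *)
Lemma tail_functional_continuous (phi : continuous_dual V) :
  continuous (fun x : X => sval phi (tail 0 x) : R).
Proof.
have head_continuous n : continuous (fun x : X => sval phi (tail 0 x - tail n x) : R).
  elim: n => [|n IH] x.
    rewrite (_ : (fun _ => _) = cst 0); first exact: cst_continuous.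
    by apply/funext => y; rewrite subrr linear0.
  have head_x : {for x, continuous (fun y : X => sval phi (tail 0 y - tail n y) : R)}.
    exact: (IH x).
  have layer_x :
      {for x, continuous (fun y : X => sval phi (tail n y - tail n.+1 y) : R)}.
    exact: (@layer_functional_continuous phi n x).
  rewrite (_ : (fun _ => _) = (fun y : X => sval phi (tail 0 y - tail n y) : R) \+
      (fun y : X => sval phi (tail n y - tail n.+1 y) : R)).
    exact: continuousD head_x layer_x.
  by apply/funext => y /=; rewrite -linearD /= addrA subrK.
move=> x0; apply/(@cvgrPdist_lt _ _ _ (nbhs x0) (nbhs_filter x0)) => eps eps0.
have [M M0 phiM] := continuous_dual_bounded phi.
have eps3 : 0 < eps / 3 by rewrite divr_gt0.
have [n nM] : exists n, M * 2^-1 ^+ n < eps / 3.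
  have Me : 0 < eps / 3 / M by rewrite divr_gt0.
  have half1 : `|2^-1 : R| < 1 by rewrite ger0_norm ?invr_ge0// invf_lt1 ?ltr1n ?ltr0n.
  have /cvgrPdist_lt/(_ _ Me)[n _ ne] := cvg_expr half1.
  exists n; have := ne n (leqnn n); rewrite /= sub0r normrN.
  rewrite ger0_norm ?exprn_ge0 ?invr_ge0//.
  by rewrite ltr_pdivlMr// mulrC.
have small y : `|sval phi (tail n y)| < eps / 3.
  apply: le_lt_trans (phiM _) _; apply: le_lt_trans nM.
  by rewrite ler_pM2l// norm_tail.
have /cvgrPdist_lt/(_ _ eps3) := head_continuous n x0.
apply: filterS => x /=; rewrite !linearB /=; have := small x; have := small x0.
set a := sval phi (tail n x0); set b := sval phi (tail n x).
set u := sval phi (tail 0 x0); set v := sval phi (tail 0 x).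
by rewrite !ltr_norml; lra.
Qed.

Lemma stone_Eberlein : Eberlein_compact R X.
Proof.
pose i x : weak_space V := tail 0 x.
have i_cont : continuous i.
  move=> x; have FF : Filter (i @ nbhs x).
    by apply: fmap_filter; exact: nbhs_filter.
  apply: (cvg_weak FF) => phi; exact: (@tail_functional_continuous phi x).
pose K : set (weak_space V) := range i.
split; [exact: stone_compact|exact: stone_hausdorff|exists V, K; split].
  apply: continuous_compact; last exact: stone_compact.
  by apply: continuous_subspaceT.
pose f x : K := SigSub (mem_set (imageT i x)).
have /choice[g gK] (y : K) : exists x, i x = set_val y.
  by have /set_mem[x _ xy] := valP y; exists x; rewrite set_valE.
(* Both coordinates are 0 or [2^-1 ^+ level h], so a smaller difference forces equality. This gives
   injectivity and the continuity of [g]. *)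
have i_eq x y h : `|tail 0 x h - tail 0 y h| < 2^-1 ^+ level h -> sval x h = sval y h.
  rewrite !tailE !leq0n !andbT.
  case: (sval x h); case: (sval y h) => //; rewrite ?subr0 ?sub0r ?normrN.
    by rewrite ger0_norm ?exprn_ge0 ?invr_ge0// ltxx.
  by rewrite ger0_norm ?exprn_ge0 ?invr_ge0// ltxx.
have half0 h : 0 < 2^-1 ^+ level h :> R by rewrite exprn_gt0 ?invr_gt0.
have i_inj x y : i x = i y -> x = y.
  move=> ixy; apply/stone_inj/funext => h; apply: i_eq.
  by rewrite -[tail 0 x]/(i x) ixy subrr normr0.
exists f, g; split.
- by move=> x; apply: i_inj; rewrite gK.
- by move=> y; apply/val_inj; exact: gK.
- move=> x U [_ [[W oW <-] Wfx] WU].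
  have /i_cont Wx : nbhs (i x) W by exact: open_nbhs_nbhs.
  have WfU : i @^-1` W `<=` f @^-1` U by move=> z Wz; exact: WU.
  exact: (@filterS _ (nbhs x) (nbhs_filter x) _ _ WfU Wx).
- move=> y U /nbhs_stone[s sU].
  suff : nbhs y [set z : K | forall h, h \in s -> sval (g z) h = sval (g y) h].
    by apply: filterS => z zy; exact: sU.
  elim: {sU} s => [|h s IH]; first by apply: filterS filterT.
  have [phi phiE] := evaluation_functional R h.
  have y_cont : {for y, continuous (fun z : K => sval phi (set_val z) : R)}.
    apply: (@continuous_comp K (weak_space V) R set_val (sval phi)).
      exact: initial_continuous.
    exact: weak_functional_continuous.
  have /cvgrPdist_lt/(_ _ (half0 h)) := y_cont.
  move=> near_y; apply: filterS (filterI near_y IH) => z [/= zy zs] k.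
  rewrite inE => /predU1P[->|/zs//].
  apply/esym/i_eq; rewrite -[tail 0 (g y)]/(i (g y)) -[tail 0 (g z)]/(i (g z)).
  by rewrite !gK -!phiE.
Qed.

End StoneEberlein.

Lemma sigma_disjointed_Eberlein (R : realType) (d : Order.disp_t)
    (A : ctbDistrLatticeType d) :
  complete_algebra A -> has_sigma_disjointed_dense_subset A ->
  exists X : topologicalType,
    [/\ Eberlein_compact R X, has_clopen_basis X & boolean_isomorphic A (RC X)].
Proof.
move=> A_complete [B [dB [B_ BB_ disjB]]].
(* Indexing by pairs makes the level a function of the index even if an element lies in several
   [B_ n]; the default [\bot] keeps each level disjoint. *)
pose e (g : nat * A) : A := if `[< B_ g.1 g.2 >] then g.2 else \bot%O.
exists (stone e); split; last 2 first.
- exact: stone_has_clopen_basis.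
- apply: stone_boolean_isomorphic A_complete => c /dB[b [Bb b0 bc]].
  move: Bb; rewrite BB_ => -[n _ Bnb]; exists (n, b).
  by rewrite /e /=; case: asboolP.
apply: (@stone_Eberlein R d A _ e fst) => -[n a] [m b] /= <- ab.
rewrite /e /=; case: asboolP => Ba; last by rewrite meet0x.
case: asboolP => Bb; last by rewrite meetx0.
by apply: disjB Ba Bb _; apply: contra_neq ab => ->.
Qed.

Theorem theorem6p5 (R : realType) (d : Order.disp_t)
    (A : ctbDistrLatticeType d) (A_complete : complete_algebra A) :
  ((exists X : topologicalType,
      Eberlein_compact R X /\ boolean_isomorphic A (RC X)) <->
    has_sigma_disjointed_dense_subset A)
  /\
  ((exists X : topologicalType,
      [/\ Eberlein_compact R X, has_clopen_basis X &
          boolean_isomorphic A (RC X)]) <->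
    has_sigma_disjointed_dense_subset A).
Proof.
have necessary (X : topologicalType) : Eberlein_compact R X ->
    boolean_isomorphic A (RC X) -> has_sigma_disjointed_dense_subset A.
  move=> /Eberlein_has_sigma_disjointed XB iso.
  exact: boolean_isomorphic_sigma_disjointed iso XB.
have sufficient := @sigma_disjointed_Eberlein R d A A_complete.
split; split=> [[X]|/sufficient[X [EX zX iso]]].
- by move=> [EX iso]; exact: necessary EX iso.
- by exists X.
- by move=> [EX _ iso]; exact: necessary EX iso.
- by exists X.
Qed.
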